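(* Let $1<p<\infty$ and let $\mathbf{T}=(T_1,\dots,T_d)$ be a $d$-tuple of commuting complex $n\times n$ matrices. If $\mathbf{T}$ is Taylor invertible, then $$\|\widetilde{\mathbf{T}}\|_{s,p}=\|\widehat{\mathbf{T}}(t)\|_{s,p}\quad\text{for every } t\in(0,1),\ t\ne\tfrac12,$$ if and only if $\mathbf{T}$ is normal.
   Context: Matrices are viewed as operators on $\mathcal{H}=\mathbb{C}^n$. A tuple $\mathbf{T}=(T_1,\dots,T_d)$ is commuting if $T_iT_j=T_jT_i$ for all $i,j$, and normal if it is commuting and each $T_k$ is normal. A commuting tuple $\mathbf{T}$ is Taylor invertible if its Koszul complex $\mathcal{K}(\mathbf{T},\mathcal{H})$ is exact; the Koszul complex is $0\to\mathcal{H}\otimes\Lambda^0\to\mathcal{H}\otimes\Lambda^1\to\cdots\to\mathcal{H}\otimes\Lambda^d\to0$, where $\Lambda^k=\Lambda^k(\mathbb{C}^d)$ and each map is $x\otimes\xi\mapsto\sum_{i=1}^dT_ix\otimes(e_i\wedge\xi)$, with $e_1,\dots,e_d$ the standard basis of $\mathbb{C}^d$ (for $d=2$: $0\to\mathcal{H}\to\mathcal{H}\oplus\mathcal{H}\to\mathcal{H}\to0$ with maps $x\mapsto(T_1x,T_2x)$ and $(x,y)\mapsto-T_2x+T_1y$). The spherical Schatten $p$-norm of a $d$-tuple is $\|\mathbf{T}\|_{s,p}=[\mathrm{tr}(P^p)]^{1/p}$, where $P=\sqrt{T_1^*T_1+\cdots+T_d^*T_d}$. Canonical spherical polar decomposition: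 $\mathbf{T}=\mathbf{V}P=(V_1P,\dots,V_dP)$, where $\mathbf{V}=(V_1,\dots,V_d)$, viewed as a column operator $\mathcal{H}\to\mathcal{H}^d$, is the partial isometry with initial space $\mathcal{N}(P)^\perp$; that is, $T_i=V_iP$ for all $i$ and $\sum_{i=1}^dV_i^*V_i$ is the orthogonal projection onto $\mathcal{N}(P)^\perp$. The spherical Aluthge transform is $\widetilde{\mathbf{T}}=(P^{1/2}V_1P^{1/2},\dots,P^{1/2}V_dP^{1/2})$; for $t\in(0,1)$ the spherical Heinz transform $\widehat{\mathbf{T}}(t)$ has coordinates $\frac12(P^tV_iP^{1-t}+P^{1-t}V_iP^t)$, $i=1,\dots,d$. *)

(* Defs.v *)
From HB Require Import structures.
From mathcomp Require Import all_boot all_order all_algebra.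
From mathcomp Require Import complex.
From mathcomp Require Import reals exp.
Set Implicit Arguments.
Unset Strict Implicit.
Unset Printing Implicit Defensive.
Import Order.TTheory GRing.Theory Num.Theory.
Local Open Scope ring_scope.
Local Open Scope sesquilinear_scope.
Local Open Scope complex_scope.

(* Matrices act on column vectors: the operator A on C^n is x |-> A *m x. *)

Section Calculus.
Context {R : realType} {n : nat}.
Implicit Types A Q : 'M[R[i]]_n.

(* f(A) for A Hermitian, which is the only case where it is used: the spectral
   theorem orthomx_spectralP gives A = U^-1 diag(s) U with U unitary, and the
   eigenvalues s are real. *)
Definition mxfun (f : R -> R) A : 'M[R[i]]_n :=
  invmx (spectralmx A)
    *m diag_mx (map_mx (fun z => (f (complex.Re z))%:C) (spectral_diag A))
    *m spectralmx A.

(* Used with t > 0 only, where 0 `^ t = 0. *)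
Definition mxpowR A (t : R) := mxfun (fun x => x `^ t) A.

Definition mxsqrt A := mxfun Num.sqrt A.

(* Q is the orthogonal projection onto the orthogonal complement of ker A *)
Definition proj_ker_ortho A Q :=
  [/\ Q *m Q = Q, Q ^t* = Q &
      forall x : 'cV[R[i]]_n,
        (exists z : 'cV[R[i]]_n, x = Q *m z) <->
        (forall y : 'cV[R[i]]_n, A *m y = 0 -> y ^t* *m x = 0)].

End Calculus.

Section Tuples.
Context {R : realType} {n d : nat}.
Implicit Types T V : 'I_d -> 'M[R[i]]_n.

Definition commuting_tuple T := forall i j, comm_mx (T i) (T j).

Definition normal_tuple T := commuting_tuple T /\ forall i, T i \is normalmx.

(* An element of H (x) Lambda(C^d) is \sum_S x_S (x) e_S, where e_S is the
   wedge of the e_j, j in S, in increasing order; it is encoded as S |-> x_S. *)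
Definition koszul_space := {ffun {set 'I_d} -> 'cV[R[i]]_n}.

(* koszul_deg k x: x lies in H (x) Lambda^k.  koszul_pred_deg k x: x lies in
   the preceding term of the complex, which is 0 when k = 0. *)
Definition koszul_deg k (x : koszul_space) :=
  forall S : {set 'I_d}, #|S| != k -> x S = 0.

Definition koszul_pred_deg k (x : koszul_space) :=
  forall S : {set 'I_d}, #|S|.+1 != k -> x S = 0.

(* For i \in S, e_i /\ e_(S \ i) = (-1)^m e_S where m counts the j < i in S,
   and e_i /\ e_S = 0; hence the coefficient of e_S in
   \sum_i \sum_S' T_i x_S' (x) (e_i /\ e_S') is as follows. *)
Definition koszul_map T (x : koszul_space) : koszul_space :=
  [ffun S : {set 'I_d} => \sum_(i in S)
     (-1) ^+ #|[set j in S | (j < i)%N]| *: (T i *m x (S :\ i))].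

(* Exactness of the Koszul complex (ker = im at every term), for commuting T. *)
Definition taylor_invertible T := forall k (x : koszul_space), koszul_deg k x ->
  (koszul_map T x = 0 <->
   exists2 y : koszul_space, koszul_pred_deg k y & koszul_map T y = x).

Definition spherical_abs T := mxsqrt (\sum_(i < d) (T i) ^t* *m T i).

Definition spherical_schatten T (p : R) : R :=
  (complex.Re (\tr (mxpowR (spherical_abs T) p))) `^ p^-1.

Definition spherical_polar T V :=
  (forall i, T i = V i *m spherical_abs T) /\
  proj_ker_ortho (spherical_abs T) (\sum_(i < d) (V i) ^t* *m V i).

Definition spherical_aluthge T V : 'I_d -> 'M[R[i]]_n := fun i =>
  let P := spherical_abs T in
  mxpowR P 2^-1 *m V i *m mxpowR P 2^-1.

Definition spherical_heinz T V (t : R) : 'I_d -> 'M[R[i]]_n := fun i =>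
  let P := spherical_abs T in
  2^-1 *: (mxpowR P t *m V i *m mxpowR P (1 - t)
           + mxpowR P (1 - t) *m V i *m mxpowR P t).

End Tuples.

(* Main.v *)
Require Import Defs.
From HB Require Import structures.
From mathcomp Require Import all_boot all_order all_algebra.
From mathcomp Require Import boolp classical_sets filter.
From mathcomp Require Import complex reals topology normedtype sequences.
From mathcomp Require Import derive exp.
From mathcomp Require Import ring lra.
Import Order.TTheory GRing.Theory Num.Theory.
Import numFieldNormedType.Exports.
Local Open Scope ring_scope.
Set Implicit Arguments.
Unset Strict Implicit.
Unset Printing Implicit Defensive.

(** Exactness of the Koszul complex at its first term says that the [T_i] have
no common kernel, so the spherical modulus [P] is positive definite.  Put
[K = ln P] and [A_i = P^(1/2) V_i P^(1/2)], the Aluthge transform.  Writing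
[t = 1/2 + s], the Heinz transform becomes the symmetric conjugate
[(e^(sK) A_i e^(-sK) + e^(-sK) A_i e^(sK)) / 2] ([spherical_heinzE]).

If [T] is normal, Fuglede's theorem makes [P] commute with every [T_i], hence
with every [V_i], and both transforms are equal to [T].

Conversely, let the norms agree for all [s] in [(0, 1/2)].  The tuple [A] is
replaced by one Hermitian matrix [X] (a self-adjoint dilation of the column
[A]) for which [tr |X|^p] is twice [tr (sum A_i^* A_i)^(p/2)]; the Heinz
transform dilates to [Y_s = (e^(sK) X e^(-sK) + e^(-sK) X e^(sK)) / 2].
Klein's inequality for the convex function [|x|^p], with derivative [h], gives
[tr h(X)(Y_s - X) <= tr |Y_s|^p - tr |X|^p = 0].  In an eigenbasis of [K] the
left side is a sum of terms [c_ab (cosh (s (k_a - k_b)) - 1)]; dividing by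
[s^2] and letting [s] tend to 0 yields [sum c_ab (k_a - k_b)^2 <= 0].  But this
sum is [tr h(X)[K,[K,X]]], which in an eigenbasis of [X] reads
[sum |K_kl|^2 (h(x_k) - h(x_l)) (x_k - x_l)].  As [h] is strictly increasing,
[K_kl] vanishes whenever [x_k <> x_l], that is, [K] commutes with [X]
([commute_of_trace_heinz_le]).  Hence [P] commutes with every [V_i].

Then the [V_i] commute with one another, and [sum V_i^* V_i = 1].  A commuting
spherical isometry of a finite-dimensional space is normal
([commuting_spherical_isometry_normal]): a joint eigenvector of [V] is a joint
eigenvector of the adjoints, so joint triangularization is diagonalization.
Finally [T_i = V_i P] is normal because [V_i] is normal and commutes with
[P]. *)

(** * Functional calculus of normal matrices *)

(** Functional calculus with complex values, over any numerically closed field,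
so that Fuglede's theorem (the function is conjugation) and the real calculus
[mxfun] are instances of one theory.  It is locked because unification would
otherwise unfold it as a product of three matrices. *)
HB.lock Definition spectral_fun (C : numClosedFieldType) (phi : C -> C) n
    (A : 'M[C]_n) : 'M[C]_n :=
  ((spectralmx A) ^t*)%sesqui *m diag_mx (map_mx phi (spectral_diag A))
    *m spectralmx A.

Section SpectralCalculus.
Local Open Scope sesquilinear_scope.
Context {C : numClosedFieldType}.

Lemma adjmxM m n p (A : 'M[C]_(m, n)) (B : 'M[C]_(n, p)) :
  (A *m B) ^t* = B ^t* *m A ^t*.
Proof. by rewrite trmx_mul map_mxM. Qed.

Lemma adjmxD m n (A B : 'M[C]_(m, n)) : (A + B) ^t* = A ^t* + B ^t*.
Proof. by rewrite raddfD map_mxD. Qed.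

Lemma adjmx_sum I (r : seq I) (Q : pred I) m n (A : I -> 'M[C]_(m, n)) :
  (\sum_(i <- r | Q i) A i) ^t* = \sum_(i <- r | Q i) (A i) ^t*.
Proof. by rewrite raddf_sum map_mx_sum. Qed.

Lemma adjmx_diag n (a : 'rV[C]_n) :
  (diag_mx a) ^t* = diag_mx (map_mx Num.conj a).
Proof. by rewrite tr_diag_mx map_diag_mx. Qed.

(** Entrywise, the hypothesis says that [Z i j] vanishes unless [a i = b j], a
condition that survives applying [phi].  All commutation properties of the
functional calculus come from this remark. *)
Lemma diag_mx_intertwine (phi : C -> C) m n (a : 'rV[C]_m) (b : 'rV[C]_n)
    (Z : 'M[C]_(m, n)) :
  diag_mx a *m Z = Z *m diag_mx b ->
  diag_mx (map_mx phi a) *m Z = Z *m diag_mx (map_mx phi b).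
Proof.
move=> /matrixP eZ; apply/matrixP => i j; have := eZ i j.
rewrite !mul_diag_mx !mul_mx_diag !mxE.
have [-> _|nz] := eqVneq (Z i j) 0; first by rewrite mulr0 mul0r.
by rewrite [RHS]mulrC => /(mulIf nz) ->; rewrite mulrC.
Qed.

Lemma hermitianP n (A : 'M[C]_n) : A ^t* = A -> A \is hermsymmx.
Proof. by move=> hA; apply/is_hermitianmxP; rewrite expr0 scale1r hA. Qed.

Lemma unitarymx_adjM n (U : 'M[C]_n) : U \is unitarymx -> U ^t* *m U = 1%:M.
Proof. by move=> uU; rewrite -invmx_unitary // mulVmx ?unitarymx_unit. Qed.

Lemma spectral_adjL n (A : 'M[C]_n) :
  (spectralmx A) ^t* *m spectralmx A = 1%:M.
Proof. exact/unitarymx_adjM/spectral_unitarymx. Qed.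

Lemma spectral_adjR n (A : 'M[C]_n) :
  spectralmx A *m (spectralmx A) ^t* = 1%:M.
Proof. exact/unitarymxP/spectral_unitarymx. Qed.

Lemma spectral_funE (phi : C -> C) n (A : 'M[C]_n) : spectral_fun phi A =
  (spectralmx A) ^t* *m diag_mx (map_mx phi (spectral_diag A)) *m spectralmx A.
Proof. by rewrite spectral_fun.unlock. Qed.

Lemma spectral_fun_id n (A : 'M[C]_n) : A \is normalmx -> spectral_fun id A = A.
Proof.
move/orthomx_spectralP => eA; rewrite [RHS]eA spectral_funE.
rewrite [map_mx id _]map_mx_id //.
by rewrite invmx_unitary ?spectral_unitarymx.
Qed.

Lemma spectral_diag_real n (A : 'M[C]_n) k : A ^t* = A ->
  spectral_diag A 0 k \is Num.real.
Proof.
by move/hermitianP/hermitian_spectral_diag_real/mxOverP.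
Qed.

Lemma herm_normal n (A : 'M[C]_n) : A ^t* = A -> A \is normalmx.
Proof. by move=> hA; exact/hermitian_normalmx/hermitianP. Qed.

Lemma eq_spectral_fun phi psi n (A : 'M[C]_n) :
  (forall k, phi (spectral_diag A 0 k) = psi (spectral_diag A 0 k)) ->
  spectral_fun phi A = spectral_fun psi A.
Proof.
move=> e; rewrite !spectral_funE; congr (_ *m diag_mx _ *m _).
by apply/rowP => k; rewrite !mxE e.
Qed.

Lemma spectral_funM phi psi n (A : 'M[C]_n) :
  spectral_fun phi A *m spectral_fun psi A = spectral_fun (fun z => phi z * psi z) A.
Proof.
rewrite !spectral_funE !mulmxA mulmxtVK ?spectral_unitarymx //.
rewrite -[_ *m diag_mx _ *m diag_mx _]mulmxA mulmx_diag; congr (_ *m diag_mx _ *m _).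
by apply/rowP => k; rewrite !mxE.
Qed.

Lemma spectral_fun1 n (A : 'M[C]_n) : spectral_fun (fun=> 1) A = 1%:M.
Proof.
have -> : spectral_fun (fun=> 1) A = (spectralmx A) ^t* *m 1%:M *m spectralmx A.
  rewrite !spectral_funE -diag_const_mx; congr (_ *m diag_mx _ *m _).
  by apply/rowP => k; rewrite !mxE.
by rewrite mulmx1 spectral_adjL.
Qed.

Lemma spectral_fun_adj phi n (A : 'M[C]_n) :
  (spectral_fun phi A) ^t* = spectral_fun (fun z => (phi z)^*) A.
Proof.
by rewrite !spectral_funE !adjmxM trmxCK adjmx_diag mulmxA -map_mx_comp.
Qed.

Lemma spectral_fun_herm phi n (A : 'M[C]_n) : (forall z, phi z \is Num.real) ->
  (spectral_fun phi A) ^t* = spectral_fun phi A.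
Proof.
by move=> r; rewrite spectral_fun_adj; apply: eq_spectral_fun => k; exact: conj_Creal.
Qed.

Lemma spectral_fun_normal phi n (A : 'M[C]_n) : spectral_fun phi A \is normalmx.
Proof.
apply/normalmxP; rewrite spectral_fun_adj !spectral_funM.
by apply: eq_spectral_fun => k; exact: mulrC.
Qed.

Lemma unitary_diag_intertwine phi m n (U : 'M[C]_m) (W : 'M[C]_n)
    (a : 'rV[C]_m) (b : 'rV[C]_n) (Z : 'M[C]_(m, n)) :
  U \is unitarymx -> W \is unitarymx ->
  U ^t* *m diag_mx a *m U *m Z = Z *m (W ^t* *m diag_mx b *m W) ->
  U ^t* *m diag_mx (map_mx phi a) *m U *m Z =
  Z *m (W ^t* *m diag_mx (map_mx phi b) *m W).
Proof.
move=> uU uW eZ.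
have UU : U ^t* *m U = 1%:M by exact: unitarymx_adjM.
have WW : W ^t* *m W = 1%:M by exact: unitarymx_adjM.
have: diag_mx a *m (U *m Z *m W ^t*) = U *m Z *m W ^t* *m diag_mx b.
  move/(congr1 (fun M => U *m M *m W ^t*)): eZ; rewrite !mulmxA.
  by rewrite (unitarymxP uU) mul1mx mulmxtVK // => ->.
move/(diag_mx_intertwine phi)/(congr1 (fun M => U ^t* *m M *m W)).
rewrite !mulmxA UU mul1mx => <-.
by rewrite -[RHS]mulmxA WW mulmx1.
Qed.

Lemma spectral_fun_intertwine phi m n (A : 'M[C]_m) (B : 'M[C]_n) (Z : 'M[C]_(m, n)) :
  A \is normalmx -> B \is normalmx ->
  A *m Z = Z *m B -> spectral_fun phi A *m Z = Z *m spectral_fun phi B.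
Proof.
move=> /spectral_fun_id eA /spectral_fun_id eB eZ.
rewrite !spectral_funE; apply: unitary_diag_intertwine; rewrite ?spectral_unitarymx //.
by move: eZ; rewrite -{1}eA -{1}eB !spectral_funE ![map_mx id _]map_mx_id.
Qed.

(** The two sides are computed in different eigenbases; the identity matrix
intertwines them. *)
Lemma spectral_fun_comp psi phi n (A : 'M[C]_n) :
  spectral_fun psi (spectral_fun phi A) = spectral_fun (psi \o phi) A.
Proof.
have /spectral_fun_id eB := spectral_fun_normal phi A.
rewrite !spectral_funE map_mx_comp -[LHS]mulmx1 -[RHS]mul1mx.
apply: unitary_diag_intertwine; rewrite ?spectral_unitarymx // mulmx1 mul1mx.
by rewrite -spectral_funE -[RHS]eB [RHS]spectral_funE [map_mx id _]map_mx_id.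
Qed.

(** Double-operator form of a trace: with [X] and [G] written in eigenbases of [A]
and [B], the functions [phi] and [psi] enter only through the product of their
values at pairs of eigenvalues. *)
Lemma mxtrace_sandwich phi psi m n (A : 'M[C]_m) (B : 'M[C]_n)
   (X : 'M[C]_(m, n)) (G : 'M[C]_(n, m)) :
  \tr (G *m spectral_fun phi A *m X *m spectral_fun psi B) =
  \sum_a \sum_b (spectralmx A *m X *m (spectralmx B) ^t*) a b *
     (spectralmx B *m G *m (spectralmx A) ^t*) b a *
     (phi (spectral_diag A 0 a) * psi (spectral_diag B 0 b)).
Proof.
set U := spectralmx A; set W := spectralmx B.
set Z := U *m X *m _; set Y := W *m G *m _.
have -> : \tr (G *m spectral_fun phi A *m X *m spectral_fun psi B) =
    \tr (Y *m diag_mx (map_mx phi (spectral_diag A)) *m Z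
             *m diag_mx (map_mx psi (spectral_diag B))).
  by rewrite !spectral_funE !mulmxA mxtrace_mulC !mulmxA.
rewrite exchange_big /=; apply: eq_bigr => b _; rewrite mul_mx_diag !mxE mulr_suml.
by apply: eq_bigr => a _; rewrite mul_mx_diag !mxE; ring.
Qed.

Lemma mxtrace_spectral_fun phi n (A : 'M[C]_n) :
  \tr (spectral_fun phi A) = \sum_k phi (spectral_diag A 0 k).
Proof.
rewrite !spectral_funE mxtrace_mulC mulmxA spectral_adjR mul1mx.
by rewrite mxtrace_diag; apply: eq_bigr => k _; rewrite mxE.
Qed.

End SpectralCalculus.

(** * Trace pairings and Klein's inequality *)

Section TracePairings.
Local Open Scope sesquilinear_scope.
Context {C : numClosedFieldType}.

(** A tangent-line inequality for scalars passes to traces: every term is an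
average, with the common weights [w k l = |<u_k, w_l>|^2] of the two
eigenbases, of its scalar version at the eigenvalues of [X] and [Y]. *)
Lemma klein_inequality F h n (X Y : 'M[C]_n) : X ^t* = X -> Y ^t* = Y ->
  {in Num.real &, forall x y, F x + h x * (y - x) <= F y} ->
  \tr (spectral_fun F X) + \tr (spectral_fun h X *m (Y - X))
    <= \tr (spectral_fun F Y).
Proof.
move=> hX hY Fh.
pose U := spectralmx X; pose W := spectralmx Y.
pose w k l := `|(U *m W ^t*) k l| ^+ 2.
have trw phi psi : \tr (spectral_fun phi X *m spectral_fun psi Y) =
    \sum_k \sum_l w k l * (phi (spectral_diag X 0 k) * psi (spectral_diag Y 0 l)).
  have := mxtrace_sandwich phi psi X Y 1%:M 1%:M.
  rewrite mulmx1 mul1mx => ->; apply: eq_bigr => k _; apply: eq_bigr => l _.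
  rewrite !mulmx1 -/U -/W /w normCK; congr (_ * _ * _).
  have -> : W *m U ^t* = (U *m W ^t*) ^t* by rewrite adjmxM trmxCK.
  by rewrite !mxE.
pose one (z : C) : C := 1; pose hid (z : C) := h z * z.
have FX : \tr (spectral_fun F X) = \tr (spectral_fun F X *m spectral_fun one Y).
  by rewrite spectral_fun1 mulmx1.
have FY : \tr (spectral_fun F Y) = \tr (spectral_fun one X *m spectral_fun F Y).
  by rewrite spectral_fun1 mul1mx.
have hXX : \tr (spectral_fun h X *m X) =
    \tr (spectral_fun hid X *m spectral_fun one Y).
  by rewrite spectral_fun1 mulmx1 -{2}[X]spectral_fun_id ?herm_normal // spectral_funM.
have hXY : \tr (spectral_fun h X *m Y) = \tr (spectral_fun h X *m spectral_fun id Y).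
  by rewrite spectral_fun_id ?herm_normal.
rewrite mulmxBr raddfB /= {}FX {}FY {}hXX {}hXY !trw -sumrB -big_split /=.
apply: ler_sum => k _; rewrite -sumrB -big_split /=.
apply: ler_sum => l _; rewrite -!(mulrBr, mulrDr).
apply: ler_wpM2l; first by rewrite exprn_ge0.
have := Fh _ _ (spectral_diag_real k hX) (spectral_diag_real l hY).
by rewrite /hid /one mulr1 mul1r mulrBr mulr1.
Qed.

Definition heinz_mean n (Q S X : 'M[C]_n) : 'M[C]_n :=
  2^-1 *: (Q *m X *m S + S *m X *m Q).

Lemma heinz_mean_adj n (Q S X : 'M[C]_n) : Q ^t* = Q -> S ^t* = S ->
  (heinz_mean Q S X) ^t* = heinz_mean Q S (X ^t*).
Proof.
move=> hQ hS; rewrite /heinz_mean linearZ map_mxZ adjmxD !adjmxM hQ hS !mulmxA addrC.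
by congr (_ *: _); apply: conj_Creal; rewrite rpredV realn.
Qed.

Section Pairing.
Context {n : nat}.
Variables (G X K : 'M[C]_n).

(** The weight that the pair of eigenvalues [(k_a, k_b)] of [K] carries in
[tr (G phi(K) X psi(K))]. *)
Definition spectral_pairing a b :=
  (spectralmx K *m X *m (spectralmx K) ^t*) a b *
  (spectralmx K *m G *m (spectralmx K) ^t*) b a.

Lemma mxtrace_heinz_diff phi psi :
  \tr (G *m (heinz_mean (spectral_fun phi K) (spectral_fun psi K) X - X)) =
  \sum_a \sum_b spectral_pairing a b *
    (2^-1 * (phi (spectral_diag K 0 a) * psi (spectral_diag K 0 b)
             + psi (spectral_diag K 0 a) * phi (spectral_diag K 0 b)) - 1).
Proof.
have GX : \tr (G *m X) =
    \tr (G *m spectral_fun (fun=> 1) K *m X *m spectral_fun (fun=> 1) K).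
  by rewrite spectral_fun1 !mulmx1.
rewrite /heinz_mean mulmxBr -scalemxAr mulmxDr raddfB /= linearZ /= raddfD /= GX.
rewrite !mulmxA !mxtrace_sandwich -big_split /= mulr_sumr -sumrB.
apply: eq_bigr => a _; rewrite -big_split /= mulr_sumr -sumrB.
by apply: eq_bigr => b _; rewrite /spectral_pairing; ring.
Qed.

End Pairing.

(** Both sides equal [tr (h(X) [K, [K, X]])], computed in an eigenbasis of [K] on
the left and of [X] on the right; the second form exposes the sign. *)
Lemma spectral_pairing_double_commutator h n (X K : 'M[C]_n) :
  X ^t* = X -> K ^t* = K ->
  \sum_a \sum_b spectral_pairing (spectral_fun h X) X K a b *
    (spectral_diag K 0 a - spectral_diag K 0 b) ^+ 2 =
  \sum_k \sum_l `|(spectralmx X *m K *m (spectralmx X) ^t*) k l| ^+ 2 *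
   ((h (spectral_diag X 0 k) - h (spectral_diag X 0 l)) *
    (spectral_diag X 0 k - spectral_diag X 0 l)).
Proof.
move=> hX hK; set G := spectral_fun h X.
pose sq (z : C) := z * z; pose hid (z : C) := h z * z.
have eK : spectral_fun id K = K by rewrite spectral_fun_id ?herm_normal.
have eX : spectral_fun id X = X by rewrite spectral_fun_id ?herm_normal.
have KK : spectral_fun sq K = K *m K by rewrite -(spectral_funM id id) eK.
have GX : spectral_fun hid X = G *m X by rewrite -(spectral_funM h id) eX.
have XG : spectral_fun hid X = X *m G.
  rewrite -[X in X *m G]eX /G spectral_funM.
  by apply: eq_spectral_fun => k; rewrite mulrC.
have e1 : \tr (G *m spectral_fun sq K *m X *m spectral_fun (fun=> 1) K) =
          \tr (K *m spectral_fun (fun=> 1) X *m K *m spectral_fun hid X).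
  rewrite !spectral_fun1 !mulmx1 KK XG [RHS]mxtrace_mulC.
  by rewrite -!mulmxA mxtrace_mulC !mulmxA.
have e2 : \tr (G *m spectral_fun (fun=> 1) K *m X *m spectral_fun sq K) =
          \tr (K *m spectral_fun hid X *m K *m spectral_fun (fun=> 1) X).
  rewrite !spectral_fun1 !mulmx1 KK GX.
  by rewrite [RHS]mxtrace_mulC !mulmxA [RHS]mxtrace_mulC !mulmxA
     [RHS]mxtrace_mulC !mulmxA.
have e3 : \tr (G *m spectral_fun id K *m X *m spectral_fun id K) =
          \tr (K *m spectral_fun id X *m K *m spectral_fun h X).
  by rewrite eK eX -/G [RHS]mxtrace_mulC !mulmxA.
have e4 : \tr (G *m spectral_fun id K *m X *m spectral_fun id K) =
          \tr (K *m spectral_fun h X *m K *m spectral_fun id X).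
  by rewrite eK eX -/G [LHS]mxtrace_mulC !mulmxA.
transitivity (\tr (G *m spectral_fun sq K *m X *m spectral_fun (fun=> 1) K)
  + \tr (G *m spectral_fun (fun=> 1) K *m X *m spectral_fun sq K)
  - \tr (G *m spectral_fun id K *m X *m spectral_fun id K)
  - \tr (G *m spectral_fun id K *m X *m spectral_fun id K)).
  (* This is tr G[K,[K,X]] = tr GKKX + tr GXKK - 2 tr GKXK. *)
  rewrite !mxtrace_sandwich -big_split /= -!sumrB; apply: eq_bigr => a _.
  rewrite -big_split /= -!sumrB; apply: eq_bigr => b _.
  by rewrite /spectral_pairing /sq; ring.
rewrite e1 e2 [X in _ - X - _]e3 e4 !mxtrace_sandwich -big_split /= -!sumrB.
apply: eq_bigr => k _; rewrite -big_split /= -!sumrB; apply: eq_bigr => l _.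
set U := spectralmx X.
have -> : (U *m K *m U ^t*) l k = ((U *m K *m U ^t*) k l)^*.
  have: (U *m K *m U ^t*) ^t* = U *m K *m U ^t*.
    by rewrite !adjmxM trmxCK hK mulmxA.
  by move/matrixP/(_ l k); rewrite !mxE.
by rewrite normCK /hid; ring.
Qed.

Lemma commute_of_spectral_entries n (X K : 'M[C]_n) : X ^t* = X ->
  (forall k l, (spectralmx X *m K *m (spectralmx X) ^t*) k l != 0 ->
     spectral_diag X 0 k = spectral_diag X 0 l) ->
  K *m X = X *m K.
Proof.
move=> hX; set U := spectralmx X => e.
have UU : U ^t* *m U = 1%:M by apply: spectral_adjL.
have: U *m K *m U ^t* *m diag_mx (spectral_diag X)
    = diag_mx (spectral_diag X) *m (U *m K *m U ^t*).
  apply/matrixP => k l; rewrite mul_mx_diag mul_diag_mx mxE [RHS]mxE mulrC.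
  by have [->|/e ->//] := eqVneq ((U *m K *m U ^t*) k l) 0; rewrite !mulr0.
move/(congr1 (fun M => U ^t* *m M *m U)); rewrite !mulmxA UU mul1mx.
rewrite -[in RHS]mulmxA UU mulmx1.
have eX : U ^t* *m diag_mx (spectral_diag X) *m U = X.
  by rewrite -[RHS]spectral_fun_id ?herm_normal // spectral_funE [map_mx id _]map_mx_id.
by rewrite eX => <-; rewrite -{1}eX !mulmxA.
Qed.

End TracePairings.

(** * The scalar function |x|^p and a second-order limit *)

Section Scalar.
Context {R : realType}.

(** The derivative of [|x| ^ p] for [1 < p]. *)
Definition dpowR (p x : R) := p * (Num.sg x * `|x| `^ (p - 1)).

(** The graph of [|x| ^ p] lies above its tangents; this is Young's inequality for
the conjugate exponents [p] and [p / (p - 1)]. *)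
Lemma dpowR_subgradient (p x y : R) : 1 < p ->
  `|x| `^ p + dpowR p x * (y - x) <= `|y| `^ p.
Proof.
move=> p1; have p0 : 0 < p by lra.
have pn0 : p != 0 by lra.
have p1n0 : p - 1 != 0 by lra.
have dx : dpowR p x * x = p * `|x| `^ p.
  rewrite /dpowR -!mulrA [_ * x]mulrC (mulrA (Num.sg x)) -normrEsg; congr (_ * _).
  by rewrite mulr_powRB1.
have dy : dpowR p x * y <= `|y| `^ p + (p - 1) * `|x| `^ p.
  have yng : `|y| * `|x| `^ (p - 1) <=
      `|y| `^ p / p + (`|x| `^ (p - 1)) `^ (p / (p - 1)) / (p / (p - 1)).
    apply: conjugate_powR; rewrite ?powR_ge0 ?divr_gt0 ?subr_gt0 //.
    by field; rewrite pn0 p1n0.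
  rewrite -powRrM (_ : (p - 1) * (p / (p - 1)) = p) in yng; last by field.
  have {yng} : p * (`|y| * `|x| `^ (p - 1)) <= `|y| `^ p + (p - 1) * `|x| `^ p.
    apply: (le_trans (ler_wpM2l (ltW p0) yng)).
    by rewrite le_eqVlt; apply/orP; left; apply/eqP; field; rewrite pn0 p1n0.
  apply: le_trans; rewrite /dpowR -mulrA; apply: ler_wpM2l; first exact: ltW.
  rewrite mulrAC; apply: ler_wpM2r; first exact: powR_ge0.
  apply: le_trans (ler_norm _) _; rewrite normrM normr_sg.
  by case: (x != 0); rewrite ?mul1r ?mul0r.
by rewrite mulrBr dx; lra.
Qed.

Lemma dpowR_lt (p x y : R) : 1 < p -> x < y -> dpowR p x < dpowR p y.
Proof.
move=> p1 xy; rewrite /dpowR ltr_pM2l; last by lra.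
have p10 : 0 < p - 1 by lra.
have p1n0 : p - 1 != 0 by lra.
have mono (a b : R) : 0 <= a -> a < b -> a `^ (p - 1) < b `^ (p - 1).
  by move=> a0 ab; apply: gt0_ltr_powR => //; rewrite nnegrE //; lra.
have [y0|y0|y0] := ltgtP y 0; have [x0|x0|x0] := ltgtP x 0; try lra.
- rewrite !ltr0_sg // !mulN1r ltrN2 !ltr0_norm //; apply: mono; lra.
- rewrite ltr0_sg // gtr0_sg // mulN1r mul1r.
  have := @powR_gt0 _ `|x| (p - 1); have := @powR_gt0 _ `|y| (p - 1).
  by rewrite !normr_gt0 => /(_ (lt0r_neq0 y0)) + /(_ (ltr0_neq0 x0)); lra.
- by rewrite !gtr0_sg // !mul1r !gtr0_norm //; apply: mono; lra.
- by rewrite x0 sgr0 mul0r gtr0_sg // mul1r powR_gt0 // normr_gt0 gt_eqF.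
- by rewrite y0 sgr0 mul0r ltr0_sg // mulN1r oppr_lt0 powR_gt0 // normr_gt0 lt_eqF.
Qed.

Lemma dpowR_monotone (p x y : R) : 1 < p -> x != y ->
  0 < (dpowR p x - dpowR p y) * (x - y).
Proof.
move=> p1; rewrite neq_lt => /orP[] xy; have := dpowR_lt p1 xy => dxy.
  by rewrite nmulr_rgt0 subr_lt0.
by rewrite pmulr_rgt0 subr_gt0.
Qed.

(** The expression is the square of [(e^(sk/2) - e^(-sk/2)) / s], whose limit is
a derivative at 0. *)
Lemma second_difference_expR_cvg (k : R) :
  (s ^- 2 * (expR (s * k) + expR (- (s * k)) - 2) @[s --> 0^'] --> k ^+ 2)%classic.
Proof.
pose f (s : R) := expR (s * (k / 2)) - expR (- (s * (k / 2))).
have df : is_derive (0 : R) 1 f k.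
  rewrite /f; apply: is_derive_eq.
  by rewrite !mul0r !oppr0 expR0 !scaler0 /GRing.scale /=; field.
have fc : (s^-1 * f s @[s --> 0^'] --> k)%classic.
  have /cvg_ex [l] := @ex_derive _ _ _ _ _ _ _ df.
  move=> fl; have := @derive_val _ _ _ _ _ _ _ df.
  rewrite /derive.derive (cvg_lim _ fl) // => <-.
  move: fl; apply: cvg_trans; apply: near_eq_cvg; near=> s.
  by rewrite /f /= addr0 mul0r oppr0 subrr subr0 /GRing.scale /= mulr1.
have -> : (fun s => s ^- 2 * (expR (s * k) + expR (- (s * k)) - 2)) =
          (fun s => (s^-1 * f s) * (s^-1 * f s)).
  apply/funext => s; rewrite mulrACA -expr2 exprVn; congr (_ * _).
  have -> : s * k = s * (k / 2) + s * (k / 2) by field.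
  rewrite /f opprD !expRD.
  have := expRxMexpNx_1 (s * (k / 2)); set a := expR _; set b := expR _ => e.
  by rewrite (_ : 2 = 2 * (a * b)); [ring | rewrite e mulr1].
by rewrite expr2; apply: cvgM.
Unshelve. all: by end_near. Qed.

(** The summands of the hypothesis are [c_i (cosh (s k_i) - 1)]; divided by [s^2],
they tend to [c_i k_i^2 / 2]. *)
Lemma sum_sqr_le0_of_cosh_sum_le0 (I : finType) (c k : I -> R) :
  (forall s : R, 0 < s < 2^-1 ->
     \sum_i c i * (2^-1 * (expR (s * k i) + expR (- (s * k i))) - 1) <= 0) ->
  \sum_i c i * k i ^+ 2 <= 0.
Proof.
move=> h.
have cv : (\sum_i c i * (s ^- 2 * (expR (s * k i) + expR (- (s * k i)) - 2))
    @[s --> 0^'+] --> \sum_i c i * k i ^+ 2)%classic.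
  apply: (@cvg_big _ _ +%R) => [|i _]; first exact: add_continuous.
  apply: cvgM; first exact: cvg_cst.
  by apply: cvg_dnbhs_at_right; exact: second_difference_expR_cvg.
apply: (cvgr_to_le cv).
near=> s.
have s0 : 0 < s by [].
have /h hs : 0 < s < 2^-1 by rewrite s0 /=; near: s; apply: nbhs_right_lt; lra.
have -> : \sum_i c i * (s ^- 2 * (expR (s * k i) + expR (- (s * k i)) - 2)) =
   (2 * s ^- 2) * \sum_i c i * (2^-1 * (expR (s * k i) + expR (- (s * k i))) - 1).
  by rewrite mulr_sumr; apply: eq_bigr => i _; field; lra.
by rewrite mulr_ge0_le0 // mulr_ge0 // invr_ge0 exprn_ge0 // ltW.
Unshelve. all: by end_near. Qed.

End Scalar.

(** * Trace-minimality forces commutation *)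

Section Commutation.
Local Open Scope sesquilinear_scope.
Local Open Scope complex_scope.
Context {R : realType}.
Notation C := R[i].
Notation Re := (@complex.Re R).

(** Turns a real function into one that [spectral_fun] accepts; only its values
at real numbers matter. *)
Definition real_lift (f : R -> R) (z : C) : C := (f (Re z))%:C.

Lemma mxfun_spectral f n (A : 'M[C]_n) : mxfun f A = spectral_fun (real_lift f) A.
Proof.
by rewrite /mxfun spectral_funE invmx_unitary //; exact: spectral_unitarymx.
Qed.

Lemma real_lift_real f z : real_lift f z \is Num.real.
Proof. by rewrite complex_real. Qed.

Lemma mxfun_adj f n (A : 'M[C]_n) : (mxfun f A) ^t* = mxfun f A.
Proof. by rewrite mxfun_spectral; apply: spectral_fun_herm; exact: real_lift_real. Qed.

Lemma ReM_real (z : C) (x : R) : Re (z * x%:C) = Re z * x.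
Proof. by case: z => a b /=; rewrite mulr0 subr0. Qed.

Lemma Re_sum I (r : seq I) P (F : I -> C) :
  Re (\sum_(i <- r | P i) F i) = \sum_(i <- r | P i) Re (F i).
Proof. by elim/big_rec2: _ => //= i y x _ <-; case: (F i); case: x. Qed.

Lemma ReD (x y : C) : Re (x + y) = Re x + Re y. Proof. by case: x; case: y. Qed.

Lemma Re_le (x y : C) : x <= y -> Re x <= Re y.
Proof. by rewrite lecE => /andP[]. Qed.

Lemma Re_sum_spectral_pairing (g : C -> C -> C) (f : R -> R -> R) n (G X K : 'M[C]_n) :
  K ^t* = K -> (forall a b, g a%:C b%:C = (f a b)%:C) ->
  Re (\sum_a \sum_b spectral_pairing G X K a b *
      g (spectral_diag K 0 a) (spectral_diag K 0 b)) =
  \sum_(i : 'I_n * 'I_n) Re (spectral_pairing G X K i.1 i.2) *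
    f (Re (spectral_diag K 0 i.1)) (Re (spectral_diag K 0 i.2)).
Proof.
move=> hK gf; rewrite pair_big /= Re_sum; apply: eq_bigr => i _.
rewrite -ReM_real -gf RRe_real; last exact: spectral_diag_real.
by rewrite RRe_real; last exact: spectral_diag_real.
Qed.

(** Klein's inequality bounds the first-order effect of the averaged conjugation
from above by 0.  Its second-order term in [s] is the trace of [h(X)] against
the double commutator, which is a sum of nonnegative terms that all vanish only
if [K] and [X] commute. *)
Lemma commute_of_trace_heinz_le (p : R) n (X K : 'M[C]_n) : 1 < p ->
  X ^t* = X -> K ^t* = K ->
  (forall s : R, 0 < s < 2^-1 ->
    Re (\tr (mxfun (fun x => `|x| `^ p)
              (heinz_mean (mxfun (fun x => expR (s * x)) K)
                          (mxfun (fun x => expR (- s * x)) K) X))) <=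
     Re (\tr (mxfun (fun x => `|x| `^ p) X))) ->
  K *m X = X *m K.
Proof.
move=> p1 hX hK le_tr.
pose G := mxfun (dpowR p) X.
pose c (i : 'I_n * 'I_n) := Re (spectral_pairing G X K i.1 i.2).
pose k (i : 'I_n * 'I_n) :=
  Re (spectral_diag K 0 i.1) - Re (spectral_diag K 0 i.2).
have second : \sum_i c i * k i ^+ 2 <= 0.
  apply: sum_sqr_le0_of_cosh_sum_le0 => s /le_tr.
  set Q := mxfun _ K; set S := mxfun _ K; set Y := heinz_mean _ _ _ => leY.
  have hY : Y ^t* = Y.
    by rewrite heinz_mean_adj ?hX // mxfun_adj.
  have sub : {in Num.real &, forall x y : C,
      real_lift (fun x => `|x| `^ p) x + real_lift (dpowR p) x * (y - x)
      <= real_lift (fun x => `|x| `^ p) y}.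
    move=> x y xr yr; rewrite /real_lift.
    have -> : y - x = (Re y - Re x)%:C by rewrite rmorphB /= !RRe_real.
    by rewrite -rmorphM -rmorphD lecR; exact: dpowR_subgradient.
  have := klein_inequality hX hY sub.
  rewrite -!mxfun_spectral -/G => /Re_le; rewrite ReD => kl.
  have {kl leY}: Re (\tr (G *m (Y - X))) <= 0.
    by move: (le_trans kl leY); rewrite gerDl.
  rewrite /Y /Q /S !mxfun_spectral mxtrace_heinz_diff.
  pose q (s x : R) := expR (s * x).
  pose g (x y : C) := 2^-1 * (real_lift (q s) x * real_lift (q (- s)) y
                        + real_lift (q (- s)) x * real_lift (q s) y) - 1.
  pose f (x y : R) := 2^-1 * (q s x * q (- s) y + q (- s) x * q s y) - 1.
  have gf a b : g a%:C b%:C = (f a b)%:C.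
    have e2 : (2^-1 : R)%:C = 2^-1 by rewrite fmorphV rmorph_nat.
    by rewrite /f rmorphB rmorphM rmorphD !rmorphM rmorph1 /= e2.
  rewrite (Re_sum_spectral_pairing G X hK gf).
  apply: le_trans; rewrite le_eqVlt; apply/orP; left; apply/eqP.
  apply: eq_bigr => i _; congr (_ * (_ * _ - _)); rewrite -!expRD /k.
  by congr (expR _ + expR _); ring.
have := spectral_pairing_double_commutator (real_lift (dpowR p)) hX hK.
rewrite -mxfun_spectral -/G.
move/(congr1 Re).
have gf (a b : R) : (a%:C - b%:C) ^+ 2 = ((a - b) ^+ 2)%:C.
  by rewrite rmorphXn rmorphB.
rewrite (Re_sum_spectral_pairing (g := fun x y => (x - y) ^+ 2) G X hK gf).
move=> e; move: second; rewrite e => {e}.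
rewrite pair_big /= => second.
pose x j := Re (spectral_diag X 0 j).
pose gap k l := (dpowR p (x k) - dpowR p (x l)) * (x k - x l).
have xE j : spectral_diag X 0 j = (x j)%:C by rewrite RRe_real // spectral_diag_real.
have gapE a b : (real_lift (dpowR p) (spectral_diag X 0 a)
      - real_lift (dpowR p) (spectral_diag X 0 b))
    * (spectral_diag X 0 a - spectral_diag X 0 b) = (gap a b)%:C.
  by rewrite /real_lift /gap !xE [RHS]rmorphM !rmorphB.
have gap_gt0 a b : x a != x b -> 0 < gap a b by apply: dpowR_monotone.
have gap_ge0 a b : 0 <= gap a b.
  have [e|/gap_gt0/ltW//] := eqVneq (x a) (x b).
  by rewrite /gap e !subrr mulr0.
pose w (i : 'I_n * 'I_n) :=
  `|(spectralmx X *m K *m (spectralmx X) ^t*) i.1 i.2| ^+ 2 * (gap i.1 i.2)%:C.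
have w_ge0 i : true -> 0 <= w i.
  by move=> _; rewrite mulr_ge0 ?exprn_ge0 // ler0c.
have {}second : Re (\sum_i w i) <= 0.
  move: second; congr (Re _ <= _); by apply: eq_bigr => i _; rewrite gapE.
have sum0 : \sum_i w i = 0.
  have s0 : 0 <= \sum_i w i by apply: sumr_ge0.
  apply/eqP; rewrite eq_le s0 andbT lecE second andbT.
  by rewrite (ger0_Im s0).
apply: commute_of_spectral_entries => // a b nz; rewrite !xE; congr (_%:C).
apply/eqP; apply: contraT => /gap_gt0 gt.
have /eqP := psumr_eq0P w_ge0 sum0 (i := (a, b)) isT.
rewrite mulf_eq0 expf_eq0 /= normr_eq0 (negbTE nz) /=.
by move=> /eqP[] g0; rewrite g0 ltxx in gt.
Qed.
End Commutation.

(** * Ampliations and self-adjoint dilations of tuples *)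

Section Dilations.
Local Open Scope sesquilinear_scope.
Context {C : numClosedFieldType}.

(** The [j]-th coordinate embedding of [C^n] into the [r]-fold direct sum. *)
Definition copy_mx r n (j : 'I_r) : 'M[C]_(r * n, n) :=
  \matrix_(k, b) (k == mxvec_index j b)%:R.

Lemma eq_mxvec_index r n (i j : 'I_r) (a b : 'I_n) :
  (mxvec_index i a == mxvec_index j b) = (i == j) && (a == b).
Proof.
have [g gK _] := curry_mxvec_bij r n.
apply/eqP/andP => [/(congr1 g)|[/eqP-> /eqP->]//].
by rewrite (gK (i, a)) // (gK (j, b)) // => -[-> ->].
Qed.

Lemma copy_mx_adjM r n (i j : 'I_r) :
  (copy_mx n i) ^t* *m copy_mx n j = (i == j)%:R%:M.
Proof.
apply/matrixP => a b; rewrite !mxE (bigD1 (mxvec_index j b)) //= big1 ?addr0.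
  rewrite !mxE eqxx mulr1 conjC_nat.
  rewrite eq_mxvec_index [j == i]eq_sym [b == a]eq_sym.
  by case: (i == j); case: (a == b).
by move=> k /negbTE nk; rewrite !mxE nk mulr0.
Qed.

Lemma sum_copy_mx r n : \sum_(j < r) copy_mx n j *m (copy_mx n j) ^t* = 1%:M.
Proof.
apply/matrixP => k l; rewrite summxE.
case/mxvec_indexP: k => i a; rewrite (bigD1 i) //= big1 ?addr0.
  rewrite !mxE (bigD1 a) //= big1 ?addr0.
    by rewrite !mxE eqxx mul1r conjC_nat eq_sym.
  move=> b nb; rewrite !mxE eq_mxvec_index eqxx /=.
  by rewrite eq_sym (negbTE nb) mul0r.
move=> j nj; rewrite mxE big1 // => b _.
by rewrite !mxE eq_mxvec_index eq_sym (negbTE nj) mul0r.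
Qed.

Section Ampliation.
Context {n : nat} (r : nat).
Implicit Types Q S : 'M[C]_n.
Notation E := (@copy_mx r n).

Definition ampliation Q : 'M[C]_(r * n) := \sum_j E j *m Q *m (E j) ^t*.

Lemma ampliation_copy Q j : ampliation Q *m E j = E j *m Q.
Proof.
rewrite /ampliation mulmx_suml (bigD1 j) //= big1 ?addr0.
  by rewrite -mulmxA copy_mx_adjM eqxx mulmx1.
by move=> i ni; rewrite -mulmxA copy_mx_adjM (negbTE ni) raddf0 mulmx0.
Qed.

Lemma ampliation_adj Q : (ampliation Q) ^t* = ampliation (Q ^t*).
Proof.
rewrite /ampliation adjmx_sum; apply: eq_bigr => j _.
by rewrite !adjmxM trmxCK mulmxA.
Qed.

Lemma copy_ampliation Q j : (E j) ^t* *m ampliation Q = Q *m (E j) ^t*.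
Proof.
rewrite -[LHS]trmxCK adjmxM trmxCK ampliation_adj ampliation_copy.
by rewrite adjmxM trmxCK.
Qed.

(** The images of the coordinate embeddings span, so a matrix is determined by
its action on them; this identifies ampliations without computing entries. *)
Lemma ampliation_eq Q (X : 'M[C]_(r * n)) :
  (forall j, X *m E j = E j *m Q) -> X = ampliation Q.
Proof.
move=> e; rewrite -[LHS]mulmx1 -sum_copy_mx mulmx_sumr.
by apply: eq_bigr => j _; rewrite mulmxA e.
Qed.

Lemma ampliation_normal Q : Q \is normalmx -> ampliation Q \is normalmx.
Proof.
move=> /normalmxP nQ; apply/normalmxP; rewrite ampliation_adj.
transitivity (ampliation (Q *m Q ^t*)); last rewrite nQ; [|symmetry];
  by apply: ampliation_eq => j;
     rewrite -mulmxA ampliation_copy mulmxA ampliation_copy mulmxA.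
Qed.

Lemma spectral_fun_ampliation phi Q : Q \is normalmx ->
  spectral_fun phi (ampliation Q) = ampliation (spectral_fun phi Q).
Proof.
move=> nQ; apply: ampliation_eq => j; apply: spectral_fun_intertwine => //.
  exact: ampliation_normal.
exact: ampliation_copy.
Qed.

End Ampliation.

Section Dilation.
Context {n d : nat}.
Implicit Types (Q S : 'M[C]_n) (A : 'I_d -> 'M[C]_n).
Notation E := (@copy_mx d.+1 n).

(** The tuple as one operator into copies [1..d] of [C^n]; copy 0 is kept free for
the domain of the dilation. *)
Definition column_mx A : 'M[C]_(d.+1 * n, n) := \sum_i E (lift ord0 i) *m A i.

(** In block form, 0 on the diagonal, the column of [A] in one corner and its
adjoint in the other. *)
Definition dilation A : 'M[C]_(d.+1 * n) :=
  column_mx A *m (E ord0) ^t* + E ord0 *m (column_mx A) ^t*.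

Lemma dilation_adj A : (dilation A) ^t* = dilation A.
Proof. by rewrite /dilation adjmxD !adjmxM !trmxCK addrC. Qed.

Lemma copy0_column A : (E ord0) ^t* *m column_mx A = 0.
Proof.
rewrite /column_mx mulmx_sumr big1 // => i _.
by rewrite mulmxA copy_mx_adjM -(inj_eq val_inj) /= raddf0 mul0mx.
Qed.

Lemma copy_column A i : (E (lift ord0 i)) ^t* *m column_mx A = A i.
Proof.
rewrite /column_mx mulmx_sumr (bigD1 i) //= big1 ?addr0.
  by rewrite mulmxA copy_mx_adjM eqxx mul1mx.
move=> j nj; rewrite mulmxA copy_mx_adjM (inj_eq lift_inj) eq_sym (negbTE nj).
by rewrite raddf0 mul0mx.
Qed.

Lemma column_adjM A : (column_mx A) ^t* *m column_mx A = \sum_i (A i) ^t* *m A i.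
Proof.
rewrite {1}/column_mx adjmx_sum mulmx_suml; apply: eq_bigr => i _.
by rewrite adjmxM -mulmxA copy_column.
Qed.

Lemma ampliation_column Q A : ampliation d.+1 Q *m column_mx A =
  column_mx (fun i => Q *m A i).
Proof.
rewrite /column_mx mulmx_sumr; apply: eq_bigr => i _.
by rewrite mulmxA ampliation_copy mulmxA.
Qed.

Lemma column_mulr A Q : column_mx A *m Q = column_mx (fun i => A i *m Q).
Proof.
by rewrite /column_mx mulmx_suml; apply: eq_bigr => i _; rewrite mulmxA.
Qed.

Lemma column_comb (a : C) A B : a *: (column_mx A + column_mx B) =
  column_mx (fun i => a *: (A i + B i)).
Proof.
rewrite /column_mx -big_split /= scaler_sumr; apply: eq_bigr => i _.
by rewrite -scalemxAr mulmxDr.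
Qed.

(** Applied to [A_i^*], the averaged conjugation gives the adjoint of its value at
[A_i], since it is symmetric in [Q] and [S]; so both corners of the dilation
transform alike. *)
Lemma ampliation_dilation Q S A : Q ^t* = Q -> S ^t* = S ->
  heinz_mean (ampliation d.+1 Q) (ampliation d.+1 S) (dilation A) =
  dilation (fun i => heinz_mean Q S (A i)).
Proof.
move=> hQ hS.
have hA (P : 'M[C]_n) : P ^t* = P -> (ampliation d.+1 P) ^t* = ampliation d.+1 P.
  by move=> hP; rewrite ampliation_adj hP.
have half P P' :
    ampliation d.+1 P *m (column_mx A *m (E ord0) ^t*) *m ampliation d.+1 P' =
    column_mx (fun i => P *m A i *m P') *m (E ord0) ^t*.
  rewrite mulmxA ampliation_column -mulmxA copy_ampliation mulmxA.
  by rewrite column_mulr.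
have halfmean :
    heinz_mean (ampliation d.+1 Q) (ampliation d.+1 S)
      (column_mx A *m (E ord0) ^t*) =
    column_mx (fun i => heinz_mean Q S (A i)) *m (E ord0) ^t*.
  by rewrite /heinz_mean !half -mulmxDl scalemxAl column_comb.
have meanD X Y : heinz_mean (ampliation d.+1 Q) (ampliation d.+1 S) (X + Y) =
   heinz_mean (ampliation d.+1 Q) (ampliation d.+1 S) X +
   heinz_mean (ampliation d.+1 Q) (ampliation d.+1 S) Y.
  by rewrite /heinz_mean !mulmxDr !mulmxDl -scalerDr addrACA.
rewrite /dilation meanD halfmean; congr (_ + _).
rewrite -[E ord0 *m _]trmxCK -heinz_mean_adj ?hA // adjmxM trmxCK halfmean.
by rewrite adjmxM trmxCK.
Qed.

Lemma dilation_commute Q A :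
  ampliation d.+1 Q *m dilation A = dilation A *m ampliation d.+1 Q ->
  forall i, Q *m A i = A i *m Q.
Proof.
move=> e i.
have dE : dilation A *m E ord0 = column_mx A.
  rewrite /dilation mulmxDl -!mulmxA copy_mx_adjM eqxx mulmx1.
  have -> : (column_mx A) ^t* *m E ord0 = 0.
    by rewrite -[LHS]trmxCK adjmxM trmxCK copy0_column trmx0 map_mx0.
  by rewrite mulmx0 addr0.
move/(congr1 (fun M => (E (lift ord0 i)) ^t* *m M *m E ord0)): e.
rewrite -!mulmxA dE ampliation_copy (mulmxA (dilation A)) dE.
by rewrite !mulmxA copy_ampliation -mulmxA !copy_column.
Qed.

(** The square of the dilation is the direct sum of [c c^*] and [c^* c], where [c]
is the column of [A].  These have the same nonzero spectrum, and a function of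
the form [z g(z)] ignores the kernel, so each contributes the same trace. *)
Lemma mxtrace_spectral_fun_dilation (F g : C -> C) A :
  {in Num.real, forall z, F z = z ^+ 2 * g (z ^+ 2)} ->
  \tr (spectral_fun F (dilation A)) =
  2 * \tr (spectral_fun (fun z => z * g z) (\sum_i (A i) ^t* *m A i)).
Proof.
move=> Fg; set X := dilation A; set c := column_mx A.
rewrite -column_adjM -/c; set M := c ^t* *m c.
have hM : M ^t* = M by rewrite /M adjmxM trmxCK.
pose N := X *m X.
have hX : X ^t* = X by apply: dilation_adj.
have hN : N ^t* = N by rewrite /N adjmxM hX.
have E0c : (E ord0) ^t* *m c = 0 by apply: copy0_column.
have cE0 : c ^t* *m E ord0 = 0.
  by rewrite -[LHS]trmxCK adjmxM trmxCK E0c trmx0 map_mx0.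
have E00 : (E ord0) ^t* *m E ord0 = 1%:M by rewrite copy_mx_adjM eqxx.
have XE0 : X *m E ord0 = c.
  by rewrite /X /dilation -/c mulmxDl -!mulmxA E00 cE0 mulmx0 mulmx1 addr0.
have Xc : X *m c = E ord0 *m M.
  by rewrite /X /dilation -/c mulmxDl -!mulmxA E0c mulmx0 add0r.
have NE : N = c *m c ^t* + E ord0 *m M *m (E ord0) ^t*.
  rewrite /N {2}/X /dilation -/c mulmxDr !mulmxA Xc XE0 addrC.
  by rewrite /M !mulmxA.
(* F(X) is a function of N = X^2, so only N needs to be analysed. *)
have NF : spectral_fun F X = N *m spectral_fun g N.
  have eX : spectral_fun id X = X by rewrite spectral_fun_id ?herm_normal.
  have eN : spectral_fun id N = N by rewrite spectral_fun_id ?herm_normal.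
  have e2 : N = spectral_fun (fun z => z ^+ 2) X.
    by rewrite /N -eX spectral_funM eX; apply: eq_spectral_fun => k; rewrite expr2.
  rewrite -{1}eN spectral_funM e2 spectral_fun_comp; apply: eq_spectral_fun => k /=.
  exact/Fg/spectral_diag_real.
have gc : spectral_fun g N *m c = c *m spectral_fun g M.
  apply: spectral_fun_intertwine; rewrite ?herm_normal //.
  by rewrite /N -mulmxA Xc mulmxA XE0.
have gE : spectral_fun g N *m E ord0 = E ord0 *m spectral_fun g M.
  apply: spectral_fun_intertwine; rewrite ?herm_normal //.
  by rewrite /N -mulmxA XE0 Xc.
have -> : spectral_fun (fun z => z * g z) M = M *m spectral_fun g M.
  by rewrite -[X in X *m _](spectral_fun_id (herm_normal hM)) spectral_funM.
rewrite NF NE mulmxDl raddfD /= -NE.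
have -> : \tr (c *m c ^t* *m spectral_fun g N) = \tr (M *m spectral_fun g M).
  by rewrite -mulmxA mxtrace_mulC -mulmxA gc mulmxA.
have -> : \tr (E ord0 *m M *m (E ord0) ^t* *m spectral_fun g N) =
          \tr (M *m spectral_fun g M).
  rewrite -!mulmxA mxtrace_mulC -!mulmxA gE (mulmxA ((E ord0) ^t*)) E00.
  by rewrite mul1mx.
by rewrite mulr2n mulrDl mul1r.
Qed.

End Dilation.
End Dilations.

(** * Commuting spherical isometries *)

Section Isometries.
Local Open Scope sesquilinear_scope.
Context {C : numClosedFieldType}.

Definition hdot n (u v : 'cV[C]_n) : C := \tr (u ^t* *m v).

Lemma hdotBr n (u v w : 'cV[C]_n) : hdot u (v - w) = hdot u v - hdot u w.
Proof. by rewrite /hdot mulmxBr raddfB. Qed.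

Lemma hdotC n (u v : 'cV[C]_n) : hdot u v = (hdot v u)^*.
Proof. by rewrite /hdot -trace_map_mx -[RHS]mxtrace_tr map_trmx adjmxM trmxCK. Qed.

Lemma hdotBl n (u v w : 'cV[C]_n) : hdot (v - w) u = hdot v u - hdot w u.
Proof. by rewrite hdotC hdotBr rmorphB /= -!hdotC. Qed.

Lemma hdotZr n a (u v : 'cV[C]_n) : hdot u (a *: v) = a * hdot u v.
Proof. by rewrite /hdot -scalemxAr linearZ. Qed.

Lemma hdotZl n a (u v : 'cV[C]_n) : hdot (a *: u) v = a^* * hdot u v.
Proof. by rewrite hdotC hdotZr rmorphM /= -hdotC. Qed.

Lemma hdot_adjl n (A : 'M[C]_n) (u v : 'cV[C]_n) :
  hdot (A ^t* *m u) v = hdot u (A *m v).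
Proof. by rewrite /hdot adjmxM trmxCK mulmxA. Qed.

Lemma hdot_adjr n (A : 'M[C]_n) (u v : 'cV[C]_n) :
  hdot u (A ^t* *m v) = hdot (A *m u) v.
Proof. by rewrite /hdot adjmxM mulmxA. Qed.

Lemma hdot_sqr n (u : 'cV[C]_n) : hdot u u = \sum_k `|u k 0| ^+ 2.
Proof.
rewrite /hdot /mxtrace big_ord1 mxE; apply: eq_bigr => k _.
by rewrite !mxE normCK mulrC.
Qed.

Lemma hdot_ge0 n (u : 'cV[C]_n) : 0 <= hdot u u.
Proof. by rewrite hdot_sqr; apply: sumr_ge0 => k _; rewrite exprn_ge0. Qed.

Lemma hdot_eq0 n (u : 'cV[C]_n) : hdot u u = 0 -> u = 0.
Proof.
rewrite hdot_sqr => /psumr_eq0P e; apply/colP => k; rewrite mxE.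
apply/eqP; rewrite -normr_eq0 -sqrf_eq0; apply/eqP/e => // j _.
by rewrite exprn_ge0.
Qed.

Section SphericalIsometry.
Context {d n : nat}.
Variable V : 'I_d -> 'M[C]_n.
Hypothesis V_comm : forall i j, comm_mx (V i) (V j).
Hypothesis V_iso : \sum_i (V i) ^t* *m V i = 1%:M.

Lemma sum_hdot_isometry (x y : 'cV[C]_n) : \sum_i hdot (V i *m x) (V i *m y) = hdot x y.
Proof.
rewrite -[y in RHS]mul1mx -V_iso mulmx_suml /hdot mulmx_sumr raddf_sum /=.
by apply: eq_bigr => i _; rewrite adjmxM !mulmxA.
Qed.

(** Put [y = V_j^* x].  Expanding [sum_i |V_i y - l_i y|^2] with
[l_i y = V_j^* V_i x] and commutativity, the two cross terms and the two squares
all equal [|y|^2], so the sum is 0 and [y] is a joint eigenvector for the same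
[l].  Then [|y|^2 = <x, V_j y> = l_j <x, y> = |l_j|^2 |x|^2], which forces
[y = conj(l_j) x]. *)
Lemma joint_eigenvector_adj (x : 'cV[C]_n) (l : 'I_d -> C) :
  (forall i, V i *m x = l i *: x) -> forall j, (V j) ^t* *m x = (l j)^* *: x.
Proof.
move=> Vx j.
have [->|nx] := eqVneq x 0; first by rewrite mulmx0 scaler0.
have nrm : \sum_i (l i)^* * l i = 1.
  have xx : hdot x x != 0 by apply: contra_neq nx; apply: hdot_eq0.
  apply: (mulIf xx); rewrite mul1r -[RHS]sum_hdot_isometry mulr_suml.
  by apply: eq_bigr => i _; rewrite Vx hdotZr hdotZl mulrCA mulrA.
set y := (V j) ^t* *m x.
have ly i : l i *: y = (V j) ^t* *m (V i *m x) by rewrite Vx -scalemxAr.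
have cross : \sum_i hdot (V i *m y) (l i *: y) = hdot y y.
  transitivity (\sum_i hdot (V i *m (V j *m y)) (V i *m x)).
    apply: eq_bigr => i _; rewrite ly hdot_adjr (mulmxA (V j)) (V_comm j i).
    by rewrite -(mulmxA (V i)).
  by rewrite sum_hdot_isometry -hdot_adjr.
have Vy i : V i *m y = l i *: y.
  apply/eqP; rewrite -subr_eq0; apply/eqP/hdot_eq0.
  have /psumr_eq0P -> // : \sum_i hdot (V i *m y - l i *: y) (V i *m y - l i *: y) = 0.
    under eq_bigr => k _ do rewrite hdotBl !hdotBr.
    rewrite sumrB sumrB sum_hdot_isometry sumrB cross.
    under [X in _ - (X - _)]eq_bigr => k _ do rewrite hdotC.
    rewrite -rmorph_sum /= cross -hdotC.
    under eq_bigr => k _ do rewrite hdotZr hdotZl mulrA [l k * _]mulrC.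
    by rewrite -mulr_suml nrm mul1r !subrr.
  by move=> k _; apply: hdot_ge0.
apply/eqP; rewrite -subr_eq0; apply/eqP/hdot_eq0.
rewrite hdotBl !hdotBr !hdotZl !hdotZr conjCK.
have -> : hdot y y = l j * hdot x y by rewrite {1}/y hdot_adjl Vy hdotZr.
have -> : hdot y x = l j * hdot x x by rewrite hdot_adjl Vx hdotZr.
by rewrite mulrCA !subrr.
Qed.

End SphericalIsometry.

Lemma unitary_conj_iso d n (P : 'M[C]_n) (V : 'I_d -> 'M[C]_n) : P \is unitarymx ->
  \sum_i (V i) ^t* *m V i = 1%:M ->
  \sum_i (P *m V i *m P ^t*) ^t* *m (P *m V i *m P ^t*) = 1%:M.
Proof.
move=> uP iso.
have PP : P ^t* *m P = 1%:M by exact: unitarymx_adjM.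
rewrite -(unitarymxP uP) -[X in _ = X *m _]mulmx1 -iso mulmx_sumr mulmx_suml.
apply: eq_bigr => i _; rewrite !adjmxM trmxCK !mulmxA; congr (_ *m _ *m _).
by rewrite -[RHS]mulmx1 -PP !mulmxA.
Qed.

(** In a basis where all [V_i] are upper triangular, column [k] is diagonal as soon
as the rows above are.  The [k]-th basis vector is then a joint eigenvector,
hence one for the adjoints, and row [k] is diagonal as well. *)
Lemma commuting_spherical_isometry_normal d n (V : 'I_d -> 'M[C]_n) :
  (forall i j, comm_mx (V i) (V j)) -> \sum_i (V i) ^t* *m V i = 1%:M ->
  forall i, V i \is normalmx.
Proof.
move=> V_comm V_iso.
(* [cotrigonalization] yields lower triangular forms: applied to the adjoints,
   it makes the [V i] upper triangular. *)
have comm_adj : {in [seq (V i) ^t* | i : 'I_d] &, forall A B, comm_mx A B}.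
  move=> _ _ /mapP[i _ ->] /mapP[j _ ->]; rewrite /comm_mx -!adjmxM.
  by rewrite (V_comm i j).
have [P uP trigP] := cotrigonalization comm_adj.
have PP : P ^t* *m P = 1%:M by exact: unitarymx_adjM.
pose B i := P *m V i *m P ^t*.
have B_comm i j : comm_mx (B i) (B j).
  rewrite /comm_mx /B !mulmxA -!(mulmxA _ (P ^t*) P) PP !mulmx1.
  by rewrite -!(mulmxA P) (V_comm i j).
have B_iso := unitary_conj_iso uP V_iso.
have B_upper i (r k : 'I_n) : (k < r)%N -> B i r k = 0.
  move=> kr.
  have iV : (V i) ^t* \in [seq (V j) ^t* | j : 'I_d] by apply/fintype.imageP; exists i.
  have /allP/(_ _ iV) := trigP.
  rewrite /= /similar_to conjymx // => /is_trig_mxP/(_ _ _ kr) e.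
  have: (B i) ^t* k r = 0 by rewrite /B !adjmxM trmxCK mulmxA.
  by rewrite !mxE => /eqP; rewrite conjC_eq0 => /eqP.
(* Strong induction on k, simultaneously over all members of the tuple. *)
have B_diag (k : 'I_n) i (r : 'I_n) : k != r -> B i k r = 0.
  have [m] := ubnP k; elim: m => // m IH in k i r *; rewrite ltnS => km kr.
  have Bk j : B j *m delta_mx k (0 : 'I_1) = B j k k *: delta_mx k 0.
    rewrite -colE; apply/colP => s.
    rewrite [LHS]mxE [RHS]mxE [delta_mx _ _ _ _]mxE eqxx andbT.
    have [->|sk] := eqVneq s k; first by rewrite mulr1.
    rewrite mulr0; move: sk; rewrite neq_ltn => /orP[sk|/B_upper//].
    by apply: IH; [exact: leq_trans km | rewrite neq_ltn sk].
  have /colP/(_ r) := joint_eigenvector_adj B_comm B_iso Bk i.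
  rewrite -colE [LHS]mxE [RHS]mxE [delta_mx _ _ _ _]mxE eqxx andbT.
  rewrite [r == k]eq_sym (negbTE kr) mulr0.
  rewrite [LHS]mxE [X in Num.conj X]mxE.
  by move/eqP; rewrite conjC_eq0 => /eqP.
move=> i.
have VE : V i = P ^t* *m B i *m P.
  by rewrite /B !mulmxA PP mul1mx -mulmxA PP mulmx1.
have [b Bb] : exists b, B i = diag_mx b.
  by apply/diag_mxP/is_diag_mxP => r k; apply: B_diag.
apply/normalmxP; rewrite VE Bb !adjmxM trmxCK adjmx_diag.
have PPr := unitarymxP uP.
rewrite !mulmxA -!(mulmxA _ P (P ^t*)) PPr !mulmx1 -!(mulmxA (P ^t*)).
by congr (_ *m (_ *m _)); apply: diag_mxC.
Qed.

End Isometries.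

(** * Spherical modulus and polar decomposition *)

Section PositiveGram.
Local Open Scope sesquilinear_scope.
Context {C : numClosedFieldType}.

(** Fuglede's theorem: the adjoint of a normal matrix is a function of it. *)
Lemma normal_comm_adj n (A B : 'M[C]_n) : B \is normalmx ->
  A *m B = B *m A -> A *m B ^t* = B ^t* *m A.
Proof.
move=> nB AB.
have -> : B ^t* = spectral_fun Num.conj B.
  by rewrite -{1}(spectral_fun_id nB) spectral_fun_adj.
by symmetry; apply: spectral_fun_intertwine.
Qed.

Lemma sum_adjM_adj n d (T : 'I_d -> 'M[C]_n) :
  (\sum_i (T i) ^t* *m T i) ^t* = \sum_i (T i) ^t* *m T i.
Proof. by rewrite adjmx_sum; apply: eq_bigr => i _; rewrite adjmxM trmxCK. Qed.

(** The eigenvalue at a unit eigenvector [v] is [sum_i |T_i v|^2], which is not 0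
as [v] is not in the common kernel. *)
Lemma spectral_diag_sum_gt0 n d (T : 'I_d -> 'M[C]_n) :
  (forall v : 'cV[C]_n, (forall i, T i *m v = 0) -> v = 0) ->
  forall k, 0 < spectral_diag (\sum_i (T i) ^t* *m T i) 0 k.
Proof.
move=> inj k; set M := \sum_i _.
have hM : M ^t* = M by apply: sum_adjM_adj.
pose v : 'cV[C]_n := (spectralmx M) ^t* *m delta_mx k 0.
have Uv : spectralmx M *m v = delta_mx k 0 by rewrite /v mulmxA spectral_adjR mul1mx.
have vv : hdot v v = 1.
  rewrite {1}/v hdot_adjl Uv hdot_sqr (bigD1 k) //= big1 ?addr0.
    by rewrite !mxE !eqxx normr1 expr1n.
  by move=> j nj; rewrite !mxE (negbTE nj) normr0 expr0n.
have Mv : M *m v = spectral_diag M 0 k *: v.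
  rewrite -{1}(spectral_fun_id (herm_normal hM)) spectral_funE.
  rewrite [map_mx id _]map_mx_id // -mulmxA Uv.
  rewrite -mulmxA /v scalemxAr; congr (_ *m _).
  apply/colP => j; rewrite mul_diag_mx !mxE eqxx andbT.
  by have [->|] := eqVneq j k; rewrite ?mulr0.
clearbody v.
have lE : spectral_diag M 0 k = \sum_i hdot (T i *m v) (T i *m v).
  rewrite -[LHS]mulr1 -vv -hdotZr -Mv /hdot /M mulmx_suml mulmx_sumr raddf_sum /=.
  by apply: eq_bigr => i _; rewrite adjmxM !mulmxA.
have ge0 i : true -> 0 <= hdot (T i *m v) (T i *m v) by move=> _; apply: hdot_ge0.
rewrite lt_def lE sumr_ge0 // andbT; apply: contraTneq isT => s0.
have v0 : v = 0.
  by apply: inj => i; apply: hdot_eq0; apply: (psumr_eq0P ge0 s0).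
by move: vv; rewrite v0 /hdot mulmx0 raddf0 => /eqP; rewrite eq_sym oner_eq0.
Qed.

Lemma half_sum_same n (X Y Z : 'M[C]_n) :
  X = Z -> Y = Z -> 2^-1 *: (X + Y) = Z.
Proof.
move=> -> ->; rewrite scalerDr -scalerDl.
have -> : 2^-1 + 2^-1 = 1 :> C by field.
by rewrite scale1r.
Qed.

Lemma heinz_mean_sandwich n (x y h a b V : 'M[C]_n) :
  x = a *m h -> x = h *m a -> y = h *m b -> y = b *m h ->
  2^-1 *: (x *m V *m y + y *m V *m x) = heinz_mean a b (h *m V *m h).
Proof.
move=> xl xr yr yl; rewrite /heinz_mean; congr (_ *: (_ + _)).
  by rewrite xl yr !mulmxA.
by rewrite xr yl !mulmxA.
Qed.

Lemma commute_of_sandwich n (h V : 'M[C]_n) : h \in unitmx ->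
  h *m (h *m V *m h) = h *m V *m h *m h -> h *m V = V *m h.
Proof.
move=> uh; rewrite -!(mulmxA h) => /(can_inj (mulKmx uh)); rewrite mulmxA.
exact: (can_inj (mulmxK uh)).
Qed.

Lemma commute_mul n (Q A B : 'M[C]_n) : Q *m A = A *m Q -> Q *m B = B *m Q ->
  Q *m (A *m B) = A *m B *m Q.
Proof. by move=> QA QB; rewrite mulmxA QA -mulmxA QB mulmxA. Qed.

(** As [P^2] is invertible, [V_i P V_j P = V_i V_j P^2] shows that the [V_i]
commute, so they form a commuting spherical isometry. *)
Lemma normal_of_commuting_polar n d (V : 'I_d -> 'M[C]_n) (P : 'M[C]_n) :
  P \in unitmx -> P ^t* = P -> (forall i, P *m V i = V i *m P) ->
  \sum_i (V i) ^t* *m V i = 1%:M ->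
  (forall i j, comm_mx (V i *m P) (V j *m P)) ->
  forall i, V i *m P \is normalmx.
Proof.
move=> uP hP PV iso VP_comm i.
have V_comm j k : comm_mx (V j) (V k).
  have := VP_comm j k; rewrite /comm_mx !mulmxA.
  rewrite -(mulmxA (V j)) PV mulmxA -(mulmxA (V k)) PV mulmxA.
  by move=> /(can_inj (mulmxK uP))/(can_inj (mulmxK uP)).
have /normalmxP nV := commuting_spherical_isometry_normal V_comm iso i.
have PVa : P *m (V i) ^t* = (V i) ^t* *m P.
  by rewrite -{1}hP -{1}[in RHS]hP -!adjmxM PV.
have VP : V i *m P *m (P *m (V i) ^t*) = V i *m (V i) ^t* *m P *m P.
  by rewrite PVa !mulmxA -(mulmxA (V i) P) PVa !mulmxA.
have PV2 : P *m (V i) ^t* *m (V i *m P) = (V i) ^t* *m V i *m P *m P.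
  by rewrite PVa !mulmxA -(mulmxA _ P (V i)) PV !mulmxA.
by apply/normalmxP; rewrite adjmxM hP VP PV2 nV.
Qed.

End PositiveGram.

Section SphericalPolar.
Local Open Scope sesquilinear_scope.
Local Open Scope complex_scope.
Context {R : realType}.
Notation C := R[i].
Notation Re := (@complex.Re R).

Lemma mxfun_comp g f n (A : 'M[C]_n) : mxfun g (mxfun f A) = mxfun (g \o f) A.
Proof. by rewrite !mxfun_spectral spectral_fun_comp; exact: eq_spectral_fun. Qed.

Lemma eq_mxfun f g n (A : 'M[C]_n) :
  (forall k, f (Re (spectral_diag A 0 k)) = g (Re (spectral_diag A 0 k))) ->
  mxfun f A = mxfun g A.
Proof.
move=> fg; rewrite !mxfun_spectral; apply: eq_spectral_fun => k.
by rewrite /real_lift fg.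
Qed.

Lemma mxfunM f g n (A : 'M[C]_n) :
  mxfun f A *m mxfun g A = mxfun (fun x => f x * g x) A.
Proof.
rewrite !mxfun_spectral spectral_funM; apply: eq_spectral_fun => k.
by rewrite /real_lift rmorphM.
Qed.

Lemma mxfun1 n (A : 'M[C]_n) : mxfun (fun=> 1) A = 1%:M.
Proof. by rewrite mxfun_spectral -(spectral_fun1 A); apply: eq_spectral_fun. Qed.

Lemma mxfun_intertwine f n (A Z : 'M[C]_n) : A ^t* = A ->
  A *m Z = Z *m A -> mxfun f A *m Z = Z *m mxfun f A.
Proof.
move=> hA; rewrite mxfun_spectral.
by apply: spectral_fun_intertwine; exact: herm_normal.
Qed.

Lemma mxfun_ampliation f r n (A : 'M[C]_n) : A ^t* = A ->
  mxfun f (ampliation r A) = ampliation r (mxfun f A).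
Proof.
move=> hA; rewrite !mxfun_spectral.
by apply: spectral_fun_ampliation; exact: herm_normal.
Qed.

Lemma mxtrace_mxfun_ge0 f n (A : 'M[C]_n) : (forall x, 0 <= f x) ->
  0 <= Re (\tr (mxfun f A)).
Proof.
move=> f0; rewrite mxfun_spectral mxtrace_spectral_fun Re_sum.
by apply: sumr_ge0 => k _; apply: f0.
Qed.

(** With [f(x) = (sqrt x)^p], one has [|x|^p = f(x^2)], and [f(x) = x g(x)] as
[f(0) = 0]. *)
Lemma mxtrace_powR_dilation (p : R) n d (A : 'I_d -> 'M[C]_n) : p != 0 ->
  Re (\tr (mxfun (fun x => `|x| `^ p) (dilation A))) =
  2 * Re (\tr (mxpowR (spherical_abs A) p)).
Proof.
move=> p0; pose f (x : R) := Num.sqrt x `^ p; pose g x := f x / x.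
have fg x : x * g x = f x.
  have [->|x0] := eqVneq x 0; first by rewrite mul0r /f sqrtr0 powR0.
  by rewrite /g mulrCA divff ?mulr1.
have Fg : {in Num.real, forall z : C,
    real_lift (fun x => `|x| `^ p) z = z ^+ 2 * real_lift g (z ^+ 2)}.
  move=> z zr; rewrite -[in RHS](RRe_real zr) -rmorphXn /real_lift -rmorphM fg.
  by rewrite /f sqrtr_sqr.
rewrite mxfun_spectral (mxtrace_spectral_fun_dilation A Fg).
rewrite /mxpowR /spherical_abs /mxsqrt mxfun_comp.
have -> : spectral_fun (fun z => z * real_lift g z) (\sum_i (A i) ^t* *m A i) =
          mxfun f (\sum_i (A i) ^t* *m A i).
  rewrite mxfun_spectral; apply: eq_spectral_fun => k.
  have r := spectral_diag_real k (sum_adjM_adj A).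
  by rewrite -{1}(RRe_real r) /real_lift -rmorphM fg.
have -> : 2 = (2 : R)%:C by rewrite rmorph_nat.
by rewrite mulrC ReM_real mulrC.
Qed.

(** The trace of a power is nonnegative, where taking the [p]-th root is
injective, so equal norms give equal traces. *)
Lemma schatten_eq_trace_dilation (p : R) n d (A B : 'I_d -> 'M[C]_n) : 0 < p ->
  spherical_schatten B p = spherical_schatten A p ->
  Re (\tr (mxfun (fun x => `|x| `^ p) (dilation A))) <=
  Re (\tr (mxfun (fun x => `|x| `^ p) (dilation B))).
Proof.
move=> p0 eAB; have pn0 := lt0r_neq0 p0.
have le_double (x y a b : R) : x = 2 * a -> y = 2 * b -> b = a -> x <= y.
  by move=> -> -> ->.
apply: (le_double _ _ _ _ (mxtrace_powR_dilation A pn0) (mxtrace_powR_dilation B pn0)).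
have tr_ge0 (T : 'I_d -> 'M[C]_n) : Re (\tr (mxpowR (spherical_abs T) p)) \in Num.nneg.
  by rewrite nnegrE; apply: mxtrace_mxfun_ge0 => x; exact: powR_ge0.
by apply: (powR_injective _ (tr_ge0 B) (tr_ge0 A) eAB); rewrite invr_gt0.
Qed.

(** Exactness at degree 0, where nothing precedes: a common kernel vector, placed
in the component of the empty set, would be a nonzero cycle. *)
Lemma taylor_invertible_inj n d (T : 'I_d -> 'M[C]_n) : taylor_invertible T ->
  forall v : 'cV[C]_n, (forall i, T i *m v = 0) -> v = 0.
Proof.
move=> tT v Tv.
pose x : koszul_space := [ffun S : {set 'I_d} => if S == finset.set0 then v else 0].
have dx : koszul_deg 0 x.
  by move=> S; rewrite cards_eq0 ffunE => /negbTE ->.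
have x0 : koszul_map T x = 0.
  apply/ffunP => S; rewrite !ffunE big1 // => i _; rewrite ffunE.
  by case: ifP => _; rewrite ?Tv ?mulmx0 scaler0.
have [/(_ x0) [y dy yx] _] := tT 0%N x dx.
have y0 S : y S = 0 by apply: dy.
have := congr1 (fun f : koszul_space => f finset.set0) yx.
by rewrite !ffunE eqxx big1 // => i _; rewrite y0 mulmx0 scaler0.
Qed.

Section Polar.
Context {n d : nat} (T V : 'I_d -> 'M[C]_n).
Hypothesis T_inj : forall v : 'cV[C]_n, (forall i, T i *m v = 0) -> v = 0.
Hypothesis TV : spherical_polar T V.

Let M := \sum_i (T i) ^t* *m T i.
Let P := spherical_abs T.
Let hM : M ^t* = M. Proof. exact: sum_adjM_adj. Qed.

(** The logarithm of [P], formed directly from [M = P^2] so that every function of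
[P] is a function of the single matrix [M]. *)
Definition log_abs := mxfun (fun x => ln (Num.sqrt x)) M.

Lemma eig_gt0 k : 0 < Num.sqrt (Re (spectral_diag M 0 k)).
Proof.
rewrite sqrtr_gt0 -ltcR RRe_real ?spectral_diag_real //.
exact: spectral_diag_sum_gt0.
Qed.

Lemma mxpowR_absE t : mxpowR P t = mxfun (fun x => expR (t * x)) log_abs.
Proof.
rewrite /mxpowR /P /spherical_abs /mxsqrt /log_abs !mxfun_comp.
by apply: eq_mxfun => k /=; rewrite /powR gt_eqF ?eig_gt0.
Qed.

Lemma mxpowR_absD s t : mxpowR P s *m mxpowR P t = mxpowR P (s + t).
Proof.
by rewrite !mxpowR_absE mxfunM; apply: eq_mxfun => k; rewrite mulrDl expRD.
Qed.

Lemma mxpowR_abs0 : mxpowR P 0 = 1%:M.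
Proof.
rewrite mxpowR_absE -(mxfun1 log_abs); apply: eq_mxfun => k.
by rewrite mul0r expR0.
Qed.

Lemma mxpowR_abs1 : mxpowR P 1 = P.
Proof.
rewrite /mxpowR /P /spherical_abs /mxsqrt mxfun_comp; apply: eq_mxfun => k /=.
by rewrite powRr1 // sqrtr_ge0.
Qed.

Lemma mxpowR_abs_adj t : (mxpowR P t) ^t* = mxpowR P t.
Proof. exact: mxfun_adj. Qed.

Lemma mxpowR_abs_comm s (Z : 'M[C]_n) : M *m Z = Z *m M ->
  mxpowR P s *m Z = Z *m mxpowR P s.
Proof.
by rewrite /mxpowR /P /spherical_abs /mxsqrt mxfun_comp; apply: mxfun_intertwine.
Qed.

Lemma mxpowR_absVK s (X : 'M[C]_n) : X *m mxpowR P s *m mxpowR P (- s) = X.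
Proof. by rewrite -mulmxA mxpowR_absD addrN mxpowR_abs0 mulmx1. Qed.

(** Since [P] is injective, the projection onto the orthogonal complement of its
kernel is the identity. *)
Lemma polar_isometry : \sum_i (V i) ^t* *m V i = 1%:M.
Proof.
have [_ [QQ _ Qx]] := TV; set Q := \sum_i _ in QQ Qx *.
apply/matrixP => i j.
suff /colP/(_ i) : Q *m delta_mx j (0 : 'I_1) = delta_mx j 0.
  by rewrite -colE !mxE eqxx andbT.
have /Qx [z ->] : forall y : 'cV[C]_n, P *m y = 0 -> y ^t* *m delta_mx j (0 : 'I_1) = 0.
  move=> y Py; have -> : y = 0.
    rewrite -[y]mul1mx -mxpowR_abs0 -(subrr 1) addrC -mxpowR_absD mxpowR_abs1.
    by rewrite -mulmxA Py mulmx0.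
  by rewrite trmx0 map_mx0 mul0mx.
by rewrite mulmxA QQ.
Qed.

Lemma polarE i : T i = V i *m P. Proof. by have [] := TV. Qed.

Lemma polar_partE i : V i = T i *m mxpowR P (-1).
Proof. by rewrite polarE -{1}mxpowR_abs1 mxpowR_absVK. Qed.

(** Centring the parameter at [1/2] turns the Heinz transform into the averaged
conjugation of the Aluthge transform. *)
Lemma spherical_heinzE s i :
  spherical_heinz T V (2^-1 + s) i =
  heinz_mean (mxpowR P s) (mxpowR P (- s)) (spherical_aluthge T V i).
Proof.
apply: heinz_mean_sandwich; rewrite -/P mxpowR_absD; congr mxpowR; lra.
Qed.

(** Equality of the norms at [t = 1/2 + s] is equality of traces for the dilations,
which is what makes [ln P] commute with the Aluthge transform. *)
Lemma normal_of_schatten_eq (p : R) : 1 < p -> commuting_tuple T ->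
  (forall t : R, 0 < t < 1 -> t != 2^-1 ->
     spherical_schatten (spherical_aluthge T V) p =
     spherical_schatten (spherical_heinz T V t) p) ->
  normal_tuple T.
Proof.
move=> p1 T_comm eq_sch; split=> //.
set A := spherical_aluthge T V in eq_sch *.
have p0 : 0 < p by apply: lt_trans p1.
have hK : log_abs ^t* = log_abs by apply: mxfun_adj.
have KX : ampliation d.+1 log_abs *m dilation A = dilation A *m ampliation d.+1 log_abs.
  apply: (commute_of_trace_heinz_le p1); first exact: dilation_adj.
    by rewrite ampliation_adj hK.
  have expE t : mxfun (fun x => expR (t * x)) (ampliation d.+1 log_abs) =
      ampliation d.+1 (mxpowR P t).
    by rewrite mxpowR_absE; apply: mxfun_ampliation.
  move=> s /andP[s0 s1]; rewrite (expE s) (expE (- s)).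
  rewrite (ampliation_dilation A (mxpowR_abs_adj s) (mxpowR_abs_adj (- s))).
  apply: (schatten_eq_trace_dilation p0).
  have t01 : 0 < 2^-1 + s < 1 by apply/andP; split; lra.
  have t2 : 2^-1 + s != 2^-1 by rewrite gt_eqF //; lra.
  have -> : (fun i => heinz_mean (mxpowR P s) (mxpowR P (- s)) (A i)) =
            spherical_heinz T V (2^-1 + s).
    by apply/funext => i; rewrite spherical_heinzE.
  exact: eq_sch.
have KA i : log_abs *m A i = A i *m log_abs by apply: dilation_commute KX i.
have uP t : mxpowR P t \in unitmx.
  have : mxpowR P t *m mxpowR P (- t) = 1%:M.
    by rewrite mxpowR_absD subrr mxpowR_abs0.
  by case/mulmx1_unit=> ut _; exact: ut.
have hV i : mxpowR P 2^-1 *m V i = V i *m mxpowR P 2^-1.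
  have hA : mxpowR P 2^-1 *m A i = A i *m mxpowR P 2^-1.
    by rewrite mxpowR_absE; apply: mxfun_intertwine.
  exact: commute_of_sandwich (uP _) hA.
have PV i : P *m V i = V i *m P.
  have <- : mxpowR P 2^-1 *m mxpowR P 2^-1 = P.
    by rewrite mxpowR_absD -[RHS]mxpowR_abs1; congr mxpowR; lra.
  by symmetry; apply: commute_mul; symmetry; exact: hV.
move=> i; rewrite polarE; apply: normal_of_commuting_polar.
- by rewrite -mxpowR_abs1; exact: uP.
- exact: mxfun_adj.
- exact: PV.
- exact: polar_isometry.
- by move=> j k; rewrite -!polarE; exact: T_comm.
Qed.

(** By Fuglede's theorem [P ^ 2 = sum T_j^* T_j], hence every power of [P], commutes
with each [T_i] and [V_i]; so both transforms collapse to [V_i P = T_i]. *)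
Lemma schatten_eq_of_normal (p t : R) : normal_tuple T ->
  spherical_schatten (spherical_aluthge T V) p =
  spherical_schatten (spherical_heinz T V t) p.
Proof.
move=> [T_comm nT].
have MT i : M *m T i = T i *m M.
  rewrite /M mulmx_suml mulmx_sumr; apply: eq_bigr => j _.
  rewrite -mulmxA (T_comm j i) !mulmxA; congr (_ *m _).
  by symmetry; apply: normal_comm_adj => //; apply: T_comm.
have PT s i : mxpowR P s *m T i = T i *m mxpowR P s.
  exact: mxpowR_abs_comm.
have PV s i : mxpowR P s *m V i = V i *m mxpowR P s.
  rewrite polar_partE; apply: commute_mul; first exact: PT.
  apply: etrans (mxpowR_absD s (-1)) _; rewrite addrC.
  exact/esym/mxpowR_absD.
have half s i : mxpowR P s *m V i *m mxpowR P (1 - s) = T i.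
  by rewrite PV -mulmxA mxpowR_absD addrC subrK mxpowR_abs1 -polarE.
have flip (u : R) i : mxpowR P (1 - u) *m V i *m mxpowR P u = T i.
  have := half (1 - u) i; rewrite (_ : 1 - (1 - u) = u); last by lra.
  exact.
have eA : spherical_aluthge T V = T.
  apply/funext => i; have := half 2^-1 i.
  rewrite (_ : 1 - 2^-1 = 2^-1); last by lra.
  exact.
have eH : spherical_heinz T V t = T.
  by apply/funext => i; exact: half_sum_same (half t i) (flip t i).
by rewrite eA eH.
Qed.

End Polar.
End SphericalPolar.

Theorem theorem3p9 (R : realType) (n d : nat) (p : R)
    (T V : 'I_d -> 'M[R[i]]_n) :
  1 < p ->
  commuting_tuple T ->
  taylor_invertible T ->
  spherical_polar T V ->
  (forall t : R, 0 < t < 1 -> t != 2^-1 ->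
     spherical_schatten (spherical_aluthge T V) p =
     spherical_schatten (spherical_heinz T V t) p)
  <-> normal_tuple T.
Proof.
move=> p1 T_comm /taylor_invertible_inj T_inj TV; split.
  exact: normal_of_schatten_eq.
move=> nT t _ _; exact: schatten_eq_of_normal.
Qed.
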